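(* Let $G$ be a locally compact group of polynomial growth and let $G \curvearrowright X$ be a continuous action on a locally compact, second-countable Hausdorff space $X$. Suppose that $G\curvearrowright X$ admits slices. Then for every compact identity neighbourhood $K\subseteq G$ there exists an open cover $\mathcal{U}$ of $X$ with the following properties. 1. Every element of $\mathcal{U}$ is an open tube. 2. The multiplicity of $\mathcal{U}$ is at most $11^{d(G)}\cdot(\dim X+1)$. 3. For every $x\in X$ there exists $U\in\mathcal{U}$ such that $K\cdot x\subseteq U$. In particular, $$\dim_{\mathrm{tube}}(G\curvearrowright X)\le 11^{d(G)}\cdot(\dim X+1)-1 .$$
   Context: Groups are locally compact Hausdorff. $\dim X$ is the small inductive dimension of $X$ (equal to covering dimension here). A compactly generated locally compact group $G$ with compact symmetric generating set $\Omega$ (so $G=\bigcup_{n\ge0}\Omega^n$) and Haar measure $m$ is of polynomial growth if $m(\Omega^n)\le Cn^d$ for all $n \geq 1$ and some $C>0$, $d\in\mathbb{N}$; groups of polynomial growth are understood to be compactly generated. By a theorem of Breuillard there is a unique integer $d(G)\ge0$, depending only on $G$, such that $\lim_n m(\Omega^n)/n^{d(G)}$ exists and is a positive real number. For a compact identity neighbourhood $K\subseteq G$, a $K$-slice is a compact subset $S\subseteq X$ such that $K\times S\to X$, $(g,x)\mapsto gx$, is injective; then $KS$ is called a tube and its interior $(KS)^\circ$ in $X$ an open tube. The tube interior of $S$ is $\mathrm{int}_{\mathrm{tube}}(S)=S\cap(KS)^\circ$ (independent of $K$). The action admits slices if for every compact identity neighbourhood $K\subseteq G$ and every $x\in X$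 there is a $K$-slice $S$ with $x\in\mathrm{int}_{\mathrm{tube}}(S)$. The multiplicity of a family of sets is the least number $d$ such that the intersection of any $d+1$ (distinct) members is empty. The tube dimension $\dim_{\mathrm{tube}}(G\curvearrowright X)$ is the least natural number $d$ such that for all compact $K\subseteq G$ and $Y\subseteq X$ there is a family $\mathcal{U}$ of open subsets of $X$ such that (i) for all $x\in Y$ there is $U\in\mathcal{U}$ with $Kx\subseteq U$, (ii) every $U\in\mathcal{U}$ is contained in a tube, and (iii) the multiplicity of $\mathcal{U}$ is at most $d+1$; it is $\infty$ if no such $d$ exists. *)

(* Defs.v *)
From HB Require Import structures.
From mathcomp Require Import all_boot all_order all_algebra.
From mathcomp Require Import all_classical all_reals all_analysis.

Set Implicit Arguments.
Unset Strict Implicit.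
Unset Printing Implicit Defensive.

Import Order.TTheory GRing.Theory Num.Theory.

Local Open Scope classical_set_scope.
Local Open Scope ring_scope.

HB.mixin Record isTopologicalGroup G of Topological G & Group G := {
  mulg_continuous : continuous (fun p : G * G => (p.1 * p.2)%g) ;
  invg_continuous : continuous (fun g : G => g^-1%g) ;
}.

#[short(type="topologicalGroupType")]
HB.structure Definition TopologicalGroup :=
  {G of Topological G & Group G & isTopologicalGroup G}.

(* Measurable types are pointed in the library; the unit is the base point. *)
Definition pointed_group (G : topologicalGroupType) : Type := G.
HB.instance Definition _ (G : topologicalGroupType) :=
  Choice.on (pointed_group G).
HB.instance Definition _ (G : topologicalGroupType) :=
  isPointed.Build (pointed_group G) (1%g : G).

Definition borel (G : topologicalGroupType) :=
  g_sigma_algebraType (@open G : set (set (pointed_group G))).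

Section Growth.
Context (R : realType) (G : topologicalGroupType).

Definition identity_nbhd (K : set G) := nbhs (1%g : G) K.

(* Left Haar measures: the nonzero left-invariant Radon measures. *)
Record haar_measure (m : {measure set (borel G) -> \bar R}) : Prop := {
  haar_compact : forall K : set G, compact K -> (m K < +oo)%E ;
  haar_outer : forall A : set (borel G), measurable A ->
    m A = ereal_inf [set m U | U in [set U : set G | open U /\ A `<=` U]] ;
  haar_inner : forall U : set G, open U ->
    m U = ereal_sup [set m K | K in [set K : set G | compact K /\ K `<=` U]] ;
  haar_invariant : forall (g : G) (A : set (borel G)), measurable A ->
    m [set (g * a)%g | a in (A : set G)] = m A ;
  haar_nonzero : m [set: G] <> 0%E
}.

Fixpoint set_power (A : set G) (n : nat) : set G :=
  if n is n'.+1 then [set (a * b)%g | a in A & b in set_power A n']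
  else [set 1%g].

(* Nonemptiness only excludes the empty generating set of the trivial group,
   whose positive powers are empty, hence null. *)
Record compact_symmetric_generating (Omega : set G) : Prop := {
  generating_nonempty : Omega !=set0 ;
  generating_compact : compact Omega ;
  generating_symmetric : [set g^-1%g | g in Omega] = Omega ;
  generating_cover : \bigcup_n set_power Omega n = [set: G]
}.

Definition polynomial_growth : Prop :=
  exists (Omega : set G) (m : {measure set (borel G) -> \bar R})
         (C : R) (d : nat),
    [/\ compact_symmetric_generating Omega, haar_measure m, 0 < C &
      forall n, (1 <= n)%N -> (m (set_power Omega n) <= (C * n%:R ^+ d)%:E)%E].

(* [is_growth_degree d] says that d is the integer d(G) of Breuillard's
   theorem: the one that works for every Omega and every m. *)
Definition is_growth_degree (d : nat) : Prop :=
  forall (Omega : set G) (m : {measure set (borel G) -> \bar R}),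
    compact_symmetric_generating Omega -> haar_measure m ->
    exists2 c : R, 0 < c &
      (m (set_power Omega n) * (n%:R ^- d)%:E)%E @[n --> \oo] --> c%:E.

End Growth.

Definition boundary (X : topologicalType) (A : set X) : set X :=
  closure A `\` interior A.

(* [ind_lt n X] means ind X <= n - 1. *)
Fixpoint ind_lt (n : nat) (X : topologicalType) : Prop :=
  if n is n'.+1 then
    forall (x : X) (V : set X), open_nbhs x V ->
      exists U : set X,
        [/\ open_nbhs x U, U `<=` V & ind_lt n' (set_type (boundary U))]
  else [set: X] = set0.

(* Here and below, the [ereal_inf] of a set of integers bounded below is its
   least element, and +oo when the set is empty. *)
Definition small_ind (R : realType) (X : topologicalType) : \bar R :=
  ereal_inf [set (n%:R - 1)%:E | n in [set n | ind_lt n X]].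

Definition multiplicity (R : realType) (X : Type) (U : set (set X)) : \bar R :=
  ereal_inf [set d%:R%:E | d in [set d : nat |
    forall V : set (set X), V `<=` U -> (V #= `I_d.+1)%card ->
      \bigcap_(A in V) A = set0]].

Section Actions.
Context (G : topologicalGroupType) (X : topologicalType) (act : G -> X -> X).

Record continuous_action : Prop := {
  act1 : forall x, act 1%g x = x ;
  actM : forall g h x, act (g * h)%g x = act g (act h x) ;
  act_continuous : continuous (fun p : G * X => act p.1 p.2)
}.

Definition act_set (K : set G) (S : set X) : set X :=
  [set act g x | g in K & x in S].

Definition slice (K : set G) (S : set X) : Prop :=
  compact S /\ set_inj (K `*` S) (fun p : G * X => act p.1 p.2).

Definition tube (B : set X) : Prop :=
  exists (K : set G) (S : set X),
    [/\ compact K, identity_nbhd K, slice K S & B = act_set K S].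

Definition open_tube (U : set X) : Prop :=
  exists2 B, tube B & U = interior B.

Definition tube_interior (K : set G) (S : set X) : set X :=
  S `&` interior (act_set K S).

Definition admits_slices : Prop :=
  forall K : set G, compact K -> identity_nbhd K ->
    forall x : X, exists2 S, slice K S & tube_interior K S x.

Definition tube_dim (R : realType) : \bar R :=
  ereal_inf [set d%:R%:E | d in [set d : nat |
    forall (K : set G) (Y : set X), compact K -> compact Y ->
      exists U : set (set X),
        [/\ forall A, U A -> open A,
            forall x, Y x -> exists2 A, U A & act_set K [set x] `<=` A,
            forall A, U A -> exists2 B, tube B & A `<=` B
          & (multiplicity R U <= d.+1%:R%:E)%E]]].

End Actions.

(* Main.v *)
(* If ind X = n, then X is a union of n + 1 invariant sets Z, each of which meets
   every slice in a zero-dimensional set: cover X by countably many slices, take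
   countable bases of these with boundaries of dimension at most n - 1, split
   off the orbits of the boundaries, and iterate. The countable sum theorem for
   zero-dimensional sets makes the result independent of the slices used.
   For one such Z, a greedy choice produces slices S_0, S_1, ... such that the
   sets B_p (int S_j) are pairwise disjoint, where int is the tube interior and
   B_p a power of a generating set containing K, while every K x with x in Z
   lies in the interior of some B_(10 p) S_j: a slice is cut along Z into the
   part that conflicts with its predecessors and the part that does not. If a
   point lies in k of these tubes, then B_(11 p) contains k disjoint translates
   of B_p. As m(B_(11 p)) / m(B_p) tends to 11^d, this forces k <= 11^d for p
   large, so that the n + 1 families together have multiplicity at most
   11^d (n + 1). *)
Require Import Defs.
From mathcomp Require Import all_boot all_order all_algebra.
From mathcomp Require Import all_classical all_reals all_analysis.
From mathcomp Require Import zify lra.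

Set Implicit Arguments.
Unset Strict Implicit.
Unset Printing Implicit Defensive.

Import Order.TTheory GRing.Theory Num.Theory.

Local Open Scope classical_set_scope.
Local Open Scope ring_scope.
Local Open Scope ereal_scope.

(** * Zero-dimensional sets *)

Section ZeroDimensional.
Context (X : topologicalType).

Definition countable_base (b : nat -> set X) : Prop :=
  (forall n, open (b n)) /\
  forall (x : X) (O : set X), open O -> O x -> exists2 n, b n x & b n `<=` O.

Lemma second_countable_base : @second_countable X -> exists b, countable_base b.
Proof.
move=> [B /pcard_leP [f] [Bo Bb]].
(* The injection [f] is inverted by choice; integers outside its range get the empty set, which a
   base may contain. *)
pose b n := xget set0 [set A | B A /\ f A = n].
exists b; split=> [n|x O oO Ox].
  by rewrite /b; case: xgetP => [A _ [/Bo]//|_]; exact: open0.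
have /(Bb x) [A [BA Ax] AO] : nbhs x O by apply: open_nbhs_nbhs.
suff e : A = b (f A) by exists (f A); rewrite -e.
rewrite /b; case: xgetP => [A' _ [BA' ff]|/(_ A)]; last by case.
by apply: (@inj _ _ _ f); rewrite ?inE.
Qed.

Lemma locally_compact_regular : hausdorff_space X -> locally_compact [set: X] ->
  forall (x : X) (O : set X), open O -> O x ->
    exists W, [/\ open W, W x, compact (closure W) & closure W `<=` O].
Proof.
move=> hX lX x O oO Ox; have [V nV' [cV clV]] := lX x I.
have nV : nbhs x V by move: nV'; rewrite /within /=; apply: filterS => y; apply.
have /(_ O) [|W nW WO] := compact_regular hX cV nV.
  exact: open_nbhs_nbhs.
exists (interior W `&` interior V); split.
- by apply: openI; exact: open_interior.
- by [].
- apply: (subclosed_compact _ cV); first exact: closed_closure.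
  move/closure_id: clV => clV; rewrite [X in _ `<=` X]clV; apply: closureS.
  by move=> y [_ /interior_subset].
apply: subset_trans (closureS _) WO.
by move=> y [/interior_subset].
Qed.

Lemma open_setD_finite (J : set nat) (n : nat) (F : nat -> set X) (U : set X) :
  open U -> (forall k, closed (F k)) ->
  open (U `\` \bigcup_(k in [set k | (k <= n)%N /\ J k]) F k).
Proof.
move=> oU cF; rewrite setDE; apply: openI => //; apply: closed_openC.
apply: closed_bigcup => //.
apply: (@sub_finite_set _ _ `I_n.+1); last exact: finite_II.
by move=> k [].
Qed.

Definition regular : Prop :=
  forall (x : X) (O : set X), open O -> O x ->
    exists W, [/\ open W, W x & closure W `<=` O].

Hypothesis rX : regular.
Context (b : nat -> set X) (bX : countable_base b).

(** As for normality of regular Lindelof spaces: cover [P] by basic sets whose closures miss [Q],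
    and conversely, then remove from each basic set the closures of the earlier members of the other
    family. *)
Lemma separated_open_nbhs (P Q : set X) :
  closure P `&` Q = set0 -> P `&` closure Q = set0 ->
  exists U V, [/\ open U, open V, P `<=` U, Q `<=` V & U `&` V = set0].
Proof.
have [bo bb] := bX.
pose I (Q : set X) := [set n | closure (b n) `&` Q = set0].
pose U P Q := \bigcup_(n in I Q)
  (b n `\` \bigcup_(k in [set k | (k <= n)%N /\ I P k]) closure (b k)).
have oU P' Q' : open (U P' Q').
  apply: bigcup_open => n _; apply: open_setD_finite => // k.
  exact: closed_closure.
have PU P' Q' : P' `&` closure Q' = set0 -> P' `<=` U P' Q'.
  move=> PQ x Px.
  have [||W [oW Wx WQ]] := @rX x (~` closure Q').
  - by apply: closed_openC; exact: closed_closure.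
  - by move=> cx; exfalso; rewrite -[False]/(set0 x) -PQ.
  have [n bnx bnW] := bb _ _ oW Wx.
  exists n.
    rewrite /I /= -subset0 => y [/(closureS bnW)/WQ nQ Qy].
    by apply: nQ; exact: subset_closure.
  split => // -[k [_ Ik] bk]; exfalso; rewrite -[False]/(set0 x) -Ik.
  by split.
move=> PQ1 PQ2; exists (U P Q), (U Q P); split => //; first exact: PU.
  by apply: PU; rewrite setIC.
rewrite -subset0 => x [[n In [bn nb]] [m Im [bm mb]]].
have [nm|/ltnW mn] := leqP n m.
- by apply: mb; exists n => //; exact: subset_closure.
- by apply: nb; exists m => //; exact: subset_closure.
Qed.

(** The traces on [A] are open in [A] and disjoint, so neither meets the closure of the other. This
    upgrades disjointness along [A] to disjointness in [X]. *)
Lemma open_separation (A U V : set X) : open U -> open V ->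
  U `&` V `&` A = set0 ->
  exists U' V', [/\ open U', open V', U `&` A `<=` U', V `&` A `<=` V' &
    U' `&` V' = set0].
Proof.
move=> oU oV UVA.
have cl0 (U' V' : set X) : open V' -> U' `&` V' `&` A = set0 ->
    closure (U' `&` A) `&` (V' `&` A) = set0.
  move=> oV' e; rewrite -subset0 => x [clx [Vx Ax]].
  have [|y [[Uy Ay] Vy]] := clx V'; first exact: open_nbhs_nbhs.
  by exfalso; rewrite -[False]/(set0 y) -e.
apply: separated_open_nbhs; first exact: cl0.
by rewrite setIC; apply: cl0 => //; rewrite (setIC V).
Qed.

Lemma closed_separation (A E F : set X) : closed E -> closed F ->
  E `&` F `&` A = set0 ->
  exists U V, [/\ open U, open V, E `&` A `<=` U, F `&` A `<=` V &
    U `&` V = set0].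
Proof.
move=> cE cF EFA; apply: separated_open_nbhs; rewrite -subset0 => x.
- move=> [cl [Fx Ax]]; rewrite -EFA; split => //; split => //.
  by apply: cE; apply: (closureS _ cl) => ? [].
- move=> [[Ex Ax] cl]; rewrite -EFA; split => //; split => //.
  by apply: cF; apply: (closureS _ cl) => ? [].
Qed.

(* For second countable regular X, this says that the subspace A has covering
   dimension at most 0. *)
Definition zero_dim (A : set X) : Prop :=
  forall E F : set X, closed E -> closed F -> E `&` F `&` A = set0 ->
    exists U V, [/\ open U /\ open V, A `<=` U `|` V, U `&` V `&` A = set0,
      E `&` A `<=` U & F `&` A `<=` V].

Lemma zero_dim0 : zero_dim set0.
Proof.
move=> E F _ _ _; exists setT, set0; split; rewrite ?setI0 //.
by split; [exact: openT|exact: open0].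
Qed.

Lemma zero_dim_disjoint (A E F : set X) : zero_dim A ->
  closed E -> closed F -> E `&` F `&` A = set0 ->
  exists U V, [/\ open U /\ open V, A `<=` U `|` V, U `&` V = set0,
    E `&` A `<=` U & F `&` A `<=` V].
Proof.
move=> zA cE cF /(zA _ _ cE cF) [U [V [[oU oV] AUV UVA EU FV]]].
have [U' [V' [oU' oV' UU' VV' UV']]] := open_separation oU oV UVA.
exists U', V'; split => // x.
- move=> Ax; have [Ux|Vx] := AUV x Ax; first by left; apply: UU'.
  by right; apply: VV'.
- by move=> [Ex Ax]; apply: UU'; split => //; apply: EU.
- by move=> [Ex Ax]; apply: VV'; split => //; apply: FV.
Qed.

(** One stage of the countable sum theorem: a splitting of the piece of [A] in [C] is absorbed into
    [E] and [F], which are then thickened. *)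
Lemma zero_dim_closure_step (A C E F : set X) : closed C -> zero_dim (A `&` C) ->
  closed E -> closed F -> E `&` F `&` A = set0 ->
  exists E' F', [/\ closed E' /\ closed F', E' `&` F' `&` A = set0,
    E `&` A `<=` interior E', F `&` A `<=` interior F' &
    A `&` C `<=` interior E' `|` interior F'].
Proof.
move=> cC zA cE cF EFA.
have [|U [V [[oU oV] AUV UV EU FV]]] := zero_dim_disjoint zA cE cF.
  by rewrite -subset0 => x [[Ex Fx] [Ax Cx]]; rewrite -EFA.
(* Along [A], the closed set [C] minus [V] is the part of [C] on the side of [U]. *)
pose E1 := E `|` (C `\` V); pose F1 := F `|` (C `\` U).
have cD W : open W -> closed (C `\` W).
  by move=> oW; rewrite setDE; apply: closedI => //; exact: open_closedC.
have cE1 : closed E1 by apply: closedU => //; exact: cD.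
have cF1 : closed F1 by apply: closedU => //; exact: cD.
have E1F1 : E1 `&` F1 `&` A = set0.
  rewrite -subset0 => x [[[Ex|[Cx Vx]] [Fx|[Cx' Ux]]] Ax].
  - by rewrite -EFA.
  - by apply: Ux; apply: EU.
  - by apply: Vx; apply: FV.
  - by have [] := AUV x (conj Ax Cx).
have [U1 [V1 [oU1 oV1 EU1 FV1 UV1]]] := closed_separation cE1 cF1 E1F1.
(* A second separation keeps the closures apart: [U2] contains the closure of [U1] along [A] and,
   being open and disjoint from [V2], misses the closure of [V2]. *)
have [] := @closed_separation A (closure U1) F1 _ cF1.
- exact: closed_closure.
- rewrite -subset0 => x [[cx Fx] Ax].
  have [|y [Uy Vy]] := cx V1.
    by apply: open_nbhs_nbhs; split => //; apply: FV1.
  by exfalso; rewrite -[False]/(set0 y) -UV1.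
move=> U2 [V2 [oU2 oV2 EU2 FV2 UV2]].
have U1i : U1 `<=` interior (closure U1).
  by rewrite -open_subsetE //; exact: subset_closure.
have V2i : V2 `<=` interior (closure V2).
  by rewrite -open_subsetE //; exact: subset_closure.
exists (closure U1), (closure V2); split.
- by split; exact: closed_closure.
- rewrite -subset0 => x [[cU cV] Ax].
  have [|y [Uy Vy]] := cV U2.
    by apply: open_nbhs_nbhs; split => //; apply: EU2.
  by exfalso; rewrite -[False]/(set0 y) -UV2.
- by move=> x [Ex Ax]; apply/U1i/EU1; split => //; left.
- by move=> x [Ex Ax]; apply/V2i/FV2; split => //; left.
- move=> x [Ax Cx]; have [Vx|Vx] := pselect (V x).
    right; apply/V2i/FV2; split => //; right; split => // Ux.
    by exfalso; rewrite -[False]/(set0 x) -UV.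
  by left; apply/U1i/EU1; split => //; right.
Qed.

(** The pieces are distributed one at a time. Along [A] each stage lies in the interior of the next,
    so the unions of interiors are disjoint on [A]: a common point would lie in both sets of one
    later stage. *)
Lemma zero_dim_countable_union (A : set X) (C : nat -> set X) :
  (forall n, closed (C n)) -> (forall n, zero_dim (A `&` C n)) ->
  A `<=` \bigcup_n C n -> zero_dim A.
Proof.
move=> cC zA AC E F cE cF EFA.
pose inv (p : set X * set X) :=
  [/\ closed p.1, closed p.2 & p.1 `&` p.2 `&` A = set0].
pose next n (p q : set X * set X) :=
  [/\ p.1 `&` A `<=` interior q.1, p.2 `&` A `<=` interior q.2 &
    A `&` C n `<=` interior q.1 `|` interior q.2].
have step n p : exists q, inv p -> inv q /\ next n p q.
  have [[c1 c2 e]|] := pselect (inv p); last by exists p.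
  have [E' [F' [[c1' c2'] e' h1 h2 h3]]] :=
    zero_dim_closure_step (cC n) (zA n) c1 c2 e.
  by exists (E', F') => _; split; split.
pose f n p := projT1 (cid (step n p)).
have fP n p : inv p -> inv (f n p) /\ next n p (f n p).
  by rewrite /f; case: cid.
pose s := fix s n := if n is m.+1 then f m (s m) else (E, F).
have sI n : inv (s n) by elim: n => [//|n /(fP n) []].
have sn n : next n (s n) (s n.+1) by have [] := fP n _ (sI n).
have up1 (n m : nat) : (n <= m)%N -> (s n).1 `&` A `<=` (s m).1.
  move=> /subnKC <-; elim: (m - n)%N => [|k ih]; first by rewrite addn0 => ? [].
  rewrite addnS => x xA; have [h _ _] := sn (n + k)%N.
  by apply: interior_subset; apply: h; split; [exact: ih|case: xA].
have up2 (n m : nat) : (n <= m)%N -> (s n).2 `&` A `<=` (s m).2.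
  move=> /subnKC <-; elim: (m - n)%N => [|k ih]; first by rewrite addn0 => ? [].
  rewrite addnS => x xA; have [_ h _] := sn (n + k)%N.
  by apply: interior_subset; apply: h; split; [exact: ih|case: xA].
exists (\bigcup_n interior (s n).1), (\bigcup_n interior (s n).2); split.
- by split; apply: bigcup_open => n _; exact: open_interior.
- move=> x Ax; have [n _ Cx] := AC x Ax; have [_ _ h] := sn n.
  by have [] := h x (conj Ax Cx); [left|right]; exists n.+1.
- rewrite -subset0 => x [[[n _ /interior_subset nx] [m _ /interior_subset mx]] Ax].
  have [_ _ <-] := sI (maxn n m); split => //; split.
    by apply: (up1 n) => //; exact: leq_maxl.
  by apply: (up2 m) => //; exact: leq_maxr.
- by move=> x xE; have [h _ _] := sn 0%N; exists 1%N => //; apply: h.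
- by move=> x xE; have [_ h _] := sn 0%N; exists 1%N => //; apply: h.
Qed.

(** The second hypothesis says that the boundary of each [W n] relative to [C] misses [Z]. Along [Z]
    these sets are thus clopen in [C], and can be made disjoint and dealt out between [E] and
    [F]. *)
Lemma zero_dim_base (C Z : set X) (W : nat -> set X) :
  (forall n, open (W n)) ->
  (forall n, Z `&` C `&` closure (C `&` W n) `<=` W n) ->
  (forall x O, (Z `&` C) x -> open O -> O x ->
    exists2 n, W n x & C `&` W n `<=` O) ->
  zero_dim (Z `&` C).
Proof.
move=> oW bW baseW E F cE cF EF.
pose IE := [set n | C `&` W n `&` F = set0].
pose IF := [set n | ~ IE n /\ C `&` W n `&` E = set0].
(* The strict [k < n] keeps [W n] from being removed from itself; [k <= n] gives finiteness in the
   form of [open_setD_finite]. *)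
pose W' n := W n `\` \bigcup_(k in [set k | (k <= n)%N /\ ((k < n)%N /\ (IE `|` IF) k)])
  closure (C `&` W k).
have oW' n : open (W' n).
  apply: (@open_setD_finite (fun k => (k < n)%N /\ (IE `|` IF) k)) => // k.
  exact: closed_closure.
have key n k : (k < n)%N -> (IE `|` IF) k -> W' n `&` W' k `&` C = set0.
  move=> kn Ik; rewrite -subset0 => x [[[Wx nx] [Wkx _]] Cx]; apply: nx.
  by exists k; [split => //; exact: ltnW|exact: subset_closure].
have disj n k : n <> k -> (IE `|` IF) n -> (IE `|` IF) k ->
    W' n `&` W' k `&` C = set0.
  move=> + In Ik; have [nk _|kn _|->//] := ltngtP n k.
    by rewrite (setIC (W' n)); exact: key.
  exact: key.
have UV : (\bigcup_(n in IE) W' n) `&` (\bigcup_(n in IF) W' n) `&` C = set0.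
  rewrite -subset0 => x [[[n In Wn] [m Im Wm]] Cx].
  have nm : n <> m by move=> e; case: Im; rewrite -e.
  by rewrite -(disj n m) //; [left|right].
have cov : Z `&` C `<=` (\bigcup_(n in IE) W' n) `|` (\bigcup_(n in IF) W' n).
  move=> x ZC.
  have ex : exists n, `[< (IE `|` IF) n /\ W n x >].
    have [Fx|Fx] := pselect (F x).
      have [||n Wx WE] := baseW x (~` E) ZC.
      - exact: closed_openC.
      - by move=> Ex; exfalso; rewrite -[False]/(set0 x) -EF.
      exists n; apply/asboolP; split => //.
      have [?|nI] := pselect (IE n); [by left|right; split => //].
      by rewrite -subset0 => y [/WE].
    have [||n Wx WF] := baseW x (~` F) ZC => //; first exact: closed_openC.
    exists n; apply/asboolP; split => //; left.
    by rewrite /IE /= -subset0 => y [/WF].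
  (* For the least admissible index nothing is lost: by [bW], a point of [Z] in the closure of an
     earlier set would lie in that set. *)
  case: (ex_minnP ex) => n /asboolP[In Wn] nmin.
  have W'n : W' n x.
    split => // -[k [_ [kn Ik]] cl].
    have : (n <= k)%N by apply: nmin; apply/asboolP; split => //; apply: bW.
    by rewrite leqNgt kn.
  by case: In => In; [left|right]; exists n.
exists (\bigcup_(n in IE) W' n), (\bigcup_(n in IF) W' n); split => //.
- by split; apply: bigcup_open.
- by rewrite -subset0 => x [UVx [_ Cx]]; rewrite -UV.
- move=> x [Ex ZC]; have [//|[n [_ In] [Wx _]]] := cov x ZC.
  by exfalso; rewrite -[False]/(set0 x) -In; split => //; split => //; case: ZC.
- move=> x [Fx ZC]; have [[n In [Wx _]]|//] := cov x ZC.
  by exfalso; rewrite -[False]/(set0 x) -In; split => //; split => //; case: ZC.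
Qed.

End ZeroDimensional.

(** * Inductive dimension *)

Section InductiveDimension.

(** The boundary of a preimage maps into the boundary. Maps inducing the topology, rather than
    inclusions, allow subsets of [X] to be compared with boundaries inside subspaces, which are
    nested subtypes. *)
Lemma ind_lt_initial (n : nat) (T T' : topologicalType) (f : T -> T') :
  continuous f -> (forall V, open V -> exists2 V', open V' & V = f @^-1` V') ->
  ind_lt n T' -> ind_lt n T.
Proof.
elim: n => [|n ih] in T T' f *; move=> fc fi.
  move=> /= T0; rewrite -subset0 => x _.
  have : [set: T'] (f x) by [].
  by rewrite T0.
move=> iT' x V [oV Vx]; have [V' oV' VE] := fi V oV.
have [|U' [[oU' U'x] U'V' iU']] := iT' (f x) V'; first by split; rewrite ?VE in Vx.
have oU : open (f @^-1` U') by move/continuousP: fc; apply.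
exists (f @^-1` U'); split; first by split.
  by rewrite VE => y; apply: U'V'.
have fB (y : boundary (f @^-1` U')) : f (val y) \in boundary U'.
  case: y => y /= /set_mem [cly iy]; apply/mem_set; split.
    move=> B nB; have [|z [Uz Bz]] := cly (f @^-1` B); first exact: fc.
    by exists (f z).
  by move=> /interior_subset Uy; apply: iy; apply: open_nbhs_nbhs; split.
pose g (y : boundary (f @^-1` U')) : boundary U' := exist _ (f (val y)) (fB y).
apply: (ih _ _ g) => //.
  apply/continuousP => _ [A oA <-].
  exists (f @^-1` A); last by [].
  by move/continuousP: fc; apply.
move=> _ [A oA <-]; have [A' oA' ->] := fi _ oA.
by exists (set_val @^-1` A') => //; exists A'.
Qed.

Lemma ind_lt_set_type (n : nat) (X : topologicalType) (A : set X) :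
  ind_lt n X -> ind_lt n (set_type A).
Proof.
apply: (@ind_lt_initial _ _ _ set_val); first exact: initial_continuous.
by move=> _ [V oV <-]; exists V.
Qed.

Lemma ind_lt_set0 (n : nat) (X : topologicalType) : ind_lt n (set_type (@set0 X)).
Proof.
by case: n => [|n]; [rewrite /= -subset0|] => -[x /[dup] /set_mem].
Qed.

Context (X : topologicalType).

(** The last set is the boundary of the trace of [W] relative to [C], expressed in [X], so that
    inductions on dimension stay among subsets of [X]. *)
Lemma ind_lt_boundary (n : nat) (C : set X) (x : X) (O : set X) :
  ind_lt n.+1 (set_type C) -> C x -> open O -> O x ->
  exists W, [/\ open W, W x, C `&` W `<=` O &
    ind_lt n (set_type ((C `&` closure (C `&` W)) `\` W))].
Proof.
move=> iC Cx oO Ox; pose c : C := exist _ x (mem_set Cx).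
have [|U [[[W oW WU] Uc] UO iU]] := iC c (set_val @^-1` O).
  by split => //; exists O.
have WE y : U y = W (val y) by rewrite -WU.
exists W; split => //; first by rewrite WE in Uc.
  by move=> y [Cy Wy]; apply: (UO (exist _ y (mem_set Cy))); rewrite WE.
pose D := (C `&` closure (C `&` W)) `\` W.
have DC (y : D) : val y \in C by case: y => y /= /set_mem [[/mem_set]].
have DU (y : D) : exist _ (val y) (DC y) \in boundary U.
  case: y DC => y /= DD DC; case/set_mem: (DD) => -[Cy cly] Wy.
  apply/mem_set; split; last first.
    by move=> /interior_subset; rewrite WE.
  move=> B; rewrite nbhsE => -[B' [[N oN NB] B'y] B'B].
  have [|z [[Cz Wz] Nz]] := cly N.
    by apply: open_nbhs_nbhs; split => //; move: B'y; rewrite -NB.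
  exists (exist _ z (mem_set Cz)); split; first by rewrite WE.
  by apply: B'B; rewrite -NB.
pose g (y : D) : boundary U := exist _ (exist _ (val y) (DC y)) (DU y).
apply: (@ind_lt_initial _ _ _ g) iU.
  apply/continuousP => _ [_ [A oA <-] <-].
  by exists A.
move=> _ [A oA <-]; exists (set_val @^-1` (set_val @^-1` A)) => //.
by exists (set_val @^-1` A) => //; exists A.
Qed.

Lemma ind_lt_countable_base (b : nat -> set X) (n : nat) (C : set X) :
  countable_base b -> ind_lt n.+1 (set_type C) ->
  exists W : nat -> set X, [/\ forall k, open (W k),
    forall k, ind_lt n (set_type ((C `&` closure (C `&` W k)) `\` W k)) &
    forall x O, C x -> open O -> O x -> exists2 k, W k x & C `&` W k `<=` O].
Proof.
move=> [bo bb] iC.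
(* For each pair of basic sets one [W] is kept that contains the first and whose trace on [C] lies
   in the second. Where there is none, the default is the empty set, whose boundary is empty. *)
pose good (pq : nat * nat) W := [/\ open W,
  ind_lt n (set_type ((C `&` closure (C `&` W)) `\` W)),
  b pq.1 `<=` W & C `&` W `<=` b pq.2].
pose W k := if unpickle k is Some pq then xget set0 (good pq) else set0.
have e0 : (C `&` closure (C `&` set0)) `\` set0 = set0 by rewrite setD0 setI0 closure0 setI0.
have W0 pq : open (xget set0 (good pq)) /\ ind_lt n (set_type
    ((C `&` closure (C `&` xget set0 (good pq))) `\` xget set0 (good pq))).
  case: xgetP => [W' _ [] //|_]; split; first exact: open0.
  by rewrite e0; exact: ind_lt_set0.
exists W; split.
- by move=> k; rewrite /W; case: unpickle => [pq|]; [case: (W0 pq)|exact: open0].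
- move=> k; rewrite /W; case: unpickle => [pq|]; first by case: (W0 pq).
  by rewrite e0; exact: ind_lt_set0.
move=> x O Cx oO Ox; have [q bq bqO] := bb x O oO Ox.
have [W' [oW' W'x W'O iW']] := ind_lt_boundary iC Cx (bo q) bq.
have [p bp bpW] := bb x W' oW' W'x.
have gW' : good (p, q) W' by split.
exists (pickle (p, q)); rewrite /W pickleK; case: xgetP => [W1 _ [_ _ h1 h2]|/(_ W')//].
  exact: h1.
by apply: subset_trans bqO.
Qed.

End InductiveDimension.

(** * Slices *)

Lemma sigma_compact_cover (T : topologicalType) (Q : nat -> set T)
    (P : set T -> Prop) :
  (forall n, compact (Q n)) -> \bigcup_n Q n = setT -> P set0 ->
  (forall x : T, exists2 N, P N & nbhs x N) ->
  exists N : nat -> set T, (forall n, P (N n)) /\ \bigcup_n N n = setT.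
Proof.
move=> cQ QT P0 PN.
have PN' x : exists N, P N /\ nbhs (x : T) N.
  by have [N ? ?] := PN x; exists N.
have [N NP] := choice PN'.
have fin n : exists s : seq T, forall x, Q n x -> exists2 y, y \in s & N y x.
  (* Along the filter of ever longer lists, the near-covering form of compactness yields a single
     list serving all of [Q n]. *)
  pose F := filter_from setT (fun s0 : seq T => [set s : seq T | {subset s0 <= s}]).
  have FF : Filter F.
    apply: filter_from_filter => [|s1 s2 _ _]; first by exists nil.
    by exists (s1 ++ s2) => // s /= h; split=> x xs; apply: h;
      rewrite mem_cat xs ?orbT.
  have /compact_near_coveringP := cQ n.
  move=> /(_ _ F (fun s x => exists2 y, y \in s & N y x) FF) [x Qx|s0 _ h].
    exists (N x, [set s : seq T | x \in s]); first split => /=; first by case: (NP x).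
      by exists [:: x] => // s /= h; apply: h; rewrite mem_head.
    by move=> [z s] [/= Nz xs]; exists x.
  by exists s0; apply: (h s0) => /=.
have [s sP] := choice fin.
pose M k := if unpickle k is Some (n, i) then nth set0 (map N (s n)) i else set0.
exists M; split=> [k|].
  rewrite /M; case: unpickle => [[n i]|//].
  have [lt|le] := ltnP i (size (map N (s n))); last by rewrite nth_default.
  by have /mapP[y _ ->] := mem_nth set0 lt; case: (NP y).
rewrite -subTset => x _; have [n _ Qx] : (\bigcup_n Q n) x by rewrite QT.
have [y ys Ny] := sP n x Qx.
exists (pickle (n, index y (s n))) => //.
by rewrite /M pickleK (nth_map y) ?index_mem // nth_index.
Qed.

Section Slices.
Context (G : topologicalGroupType) (X : topologicalType) (act : G -> X -> X).
Hypotheses (hG : hausdorff_space G) (hX : hausdorff_space X).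
Hypothesis actP : continuous_action act.

Lemma act_continuousr (g : G) : continuous (act g).
Proof.
move=> x; apply: (@continuous_comp _ _ _ (pair g) (fun p => act p.1 p.2)).
  by apply: cvg_pair => /=; [exact: cvg_cst|exact: cvg_id].
exact: (act_continuous actP).
Qed.

Lemma actK (g : G) : cancel (act g) (act g^-1%g).
Proof. by move=> x; rewrite -(actM actP) mulVg (act1 actP). Qed.

Lemma actVK (g : G) : cancel (act g^-1%g) (act g).
Proof. by move=> x; rewrite -(actM actP) mulgV (act1 actP). Qed.

Lemma act_interior (g : G) (A B : set X) (x : X) :
  (forall y, A y -> B (act g y)) -> interior A x -> interior B (act g x).
Proof.
move=> AB Ax; have : nbhs (act g x) (act g^-1%g @^-1` A).
  by apply: act_continuousr; rewrite actK.
by apply: filterS => y /= /AB; rewrite actVK.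
Qed.

Lemma act_set_compact (K : set G) (S : set X) :
  compact K -> compact S -> compact (act_set act K S).
Proof.
move=> cK cS.
have -> : act_set act K S = (fun p => act p.1 p.2) @` (K `*` S).
  apply/seteqP; split=> [_ [g Kg [x Sx <-]]|_ [[g x] [/= Kg Sx] <-]].
    by exists (g, x).
  by exists g => //; exists x.
apply: continuous_compact; last exact: compact_setX.
by apply: continuous_subspaceT; exact: (act_continuous actP).
Qed.

Lemma sub_slice (K K' : set G) (S S' : set X) : K' `<=` K -> S' `<=` S ->
  compact S' -> slice act K S -> slice act K' S'.
Proof.
move=> KK SS cS' [_ inj]; split=> // p q /set_mem [Kp Sp] /set_mem [Kq Sq].
by apply: inj; apply/mem_set; split; auto.
Qed.

Lemma slice_inj (K : set G) (S : set X) (g h : G) (x y : X) : slice act K S ->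
  K g -> K h -> S x -> S y -> act g x = act h y -> g = h /\ x = y.
Proof.
move=> [_ inj] Kg Kh Sx Sy e.
have [] : (g, x) = (h, y) by apply: inj => //; apply/mem_set.
by [].
Qed.

Lemma slice_eq (L : set G) (S : set X) (g : G) (x y : X) : slice act L S ->
  L 1%g -> L g -> S x -> S y -> act g x = y -> x = y.
Proof.
move=> sS L1 Lg Sx Sy e.
by have [] := slice_inj sS Lg L1 Sx Sy (etrans e (esym (act1 actP y))).
Qed.

(** Being in the tube interior depends neither on the group neighbourhood nor on the slice away from
    [x]. Injectivity keeps [x] out of the closed set [P] of those points of the tube with a
    coordinate outside [interior L] or [U]. *)
Lemma slice_interior (K L : set G) (S U : set X) (x : X) :
  compact K -> slice act K S -> L `<=` K -> identity_nbhd L -> open U ->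
  (S `&` U) x -> interior (act_set act K S) x ->
  interior (act_set act L (S `&` U)) x.
Proof.
move=> cK sS LK nL oU [Sx Ux] ix; have [cS _] := sS.
have K1 : K 1%g by apply: LK; exact: nbhs_singleton.
pose P := act_set act (K `\` interior L) S `|` act_set act K (S `\` U).
have cP : closed P.
  have cD (T : topologicalType) (A B : set T) : hausdorff_space T -> compact A ->
      open B -> compact (A `\` B).
    move=> hT cA oB; rewrite setDE; apply: compact_closedI => //.
    exact: open_closedC.
  apply: compact_closed => //; apply: compactU; apply: act_set_compact => //;
    by apply: cD => //; exact: open_interior.
have nP : ~ P x.
  have eqx g s : K g -> S s -> act g s = x -> g = 1%g /\ s = x.
    by move=> Kg Ss e; apply: slice_inj sS Kg K1 Ss Sx _; rewrite (act1 actP).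
  case=> [[g [Kg Lg] [s Ss /(eqx _ _ Kg Ss)[g1 _]]]|].
    by apply: Lg; rewrite g1.
  by case=> g Kg [s [Ss Us] /(eqx _ _ Kg Ss)[_ sx]]; apply: Us; rewrite sx.
have : nbhs x (~` P) by apply: open_nbhs_nbhs; split => //; exact: closed_openC.
move: ix; apply: filterS2 => y [g Kg [s Ss e]] nPy.
exists g.
  apply: contrapT => nLg; apply: nPy; left; exists g; last by exists s.
  by split => // /interior_subset.
exists s => //; split => //; apply: contrapT => nUs; apply: nPy; right.
by exists g => //; exists s.
Qed.

Definition invariant (Z : set X) : Prop := forall g x, Z x -> Z (act g x).

(** As [N] is small relative to [L], moving along orbits by [N] matches points of [S] and [C]
    injectively. It preserves [Z], and by compactness it respects closed sets, so splittings carry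
    over from [C] to [S]. *)
Lemma zero_dim_transport (L N : set G) (S C Z : set X) :
  slice act L S -> slice act L C -> compact N -> L 1%g ->
  (forall g h, N g -> N h -> L (g * h^-1)%g /\ L (g^-1 * h)%g) ->
  invariant Z -> zero_dim (Z `&` C) -> zero_dim (Z `&` S `&` act_set act N C).
Proof.
move=> sS sC cN L1 NL iZ zC E F cE cF EF.
have [cS _] := sS; have [cC _] := sC.
have eqS g h c d : N g -> N h -> S (act g c) -> S (act h d) -> c = d ->
    act g c = act h d.
  move=> Ng Nh Sg Sh e; rewrite -e in Sh *.
  apply: (slice_eq sS L1 (proj1 (NL _ _ Nh Ng)) Sg Sh).
  by rewrite -(actM actP) mulgVK.
have eqC g h c d : N g -> N h -> C c -> C d -> act g c = act h d -> c = d.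
  move=> Ng Nh Cc Cd e.
  apply: (slice_eq sC L1 (proj2 (NL _ _ Nh Ng)) Cc Cd).
  by rewrite (actM actP) e actK.
pose V := [set g^-1%g | g in N].
have cV : compact V.
  apply: continuous_compact => //; apply: continuous_subspaceT.
  exact: invg_continuous.
(* The points of [C] that [N] moves into [A] within [S]. *)
pose pull (A : set X) := C `&` act_set act V (A `&` S).
have cpull A : closed A -> closed (pull A).
  move=> cA; apply: closedI; first exact: compact_closed.
  by apply: compact_closed => //; apply: act_set_compact => //; rewrite setIC;
    apply: compact_closedI.
have pullP A c : pull A c -> exists g, [/\ N g, A (act g c), S (act g c) & C c].
  by move=> [Cc [_ [g Ng <-] [s [As Ss] e]]]; subst c; exists g; rewrite actVK.
have pullI A g c : N g -> A (act g c) -> S (act g c) -> C c -> pull A c.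
  move=> Ng Ac Sc Cc; split=> //; exists g^-1%g; first by exists g.
  by exists (act g c) => //; rewrite actK.
have [|U [V' [[oU oV] cov UV EU FV]]] := zC _ _ (cpull E cE) (cpull F cF).
  rewrite -subset0 => c [[/pullP[g [Ng Eg Sg Cc]] /pullP[h [Nh Fh Sh _]]] [Zc _]].
  suff : set0 (act g c) by []; rewrite -EF; have e := eqS _ _ _ _ Ng Nh Sg Sh erefl.
  split; first by split; [exact: Eg|rewrite e].
  split; [split => //; exact: iZ|by exists g => //; exists c].
have cP A : open A -> closed (act_set act N (C `\` A)).
  move=> oA; apply: compact_closed => //; apply: act_set_compact => //.
  by rewrite setDE; apply: compact_closedI => //; exact: open_closedC.
have uniq g h c d : N g -> N h -> C c -> C d -> Z (act g c) ->
    act h d = act g c -> d = c /\ (Z `&` C) c.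
  move=> Ng Nh Cc Cd /(iZ g^-1%g); rewrite actK => Zc /eqC ->//.
(* By [uniq], on the points in question these complements say that the matching point of [C] lies in
   [U], respectively [V']. *)
exists (~` act_set act N (C `\` U)), (~` act_set act N (C `\` V')); split.
- by split; apply: closed_openC; exact: cP.
- move=> x [[Zx Sx] [g Ng [c Cc ec]]] /=; subst x.
  apply: contrapT => /not_orP [/contrapT [h Nh [c' [Cc' Uc'] e1]]
    /contrapT [k Nk [c'' [Cc'' Vc''] e2]]].
  have [ec' Zc] := uniq _ _ _ _ Ng Nh Cc Cc' Zx e1.
  have [ec'' _] := uniq _ _ _ _ Ng Nk Cc Cc'' Zx e2.
  by have [] := cov c Zc; [rewrite -ec'|rewrite -ec''].
- rewrite -subset0 => x [[/= nU nV] [[Zx Sx] [g Ng [c Cc ec]]]]; subst.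
  have [_ Zc] := uniq _ _ _ _ Ng Ng Cc Cc Zx erefl.
  suff : set0 c by []; rewrite -UV; split => //; split; apply: contrapT => n.
    by apply: nU; exists g => //; exists c.
  by apply: nV; exists g => //; exists c.
- move=> x [Ex [[Zx Sx] [g Ng [c Cc ec]]]] [h Nh [d [Cd Ud] e]]; subst.
  have [ed Zc] := uniq _ _ _ _ Ng Nh Cc Cd Zx e.
  by apply: Ud; rewrite ed; apply: EU; split => //; exact: (pullI _ g).
- move=> x [Fx [[Zx Sx] [g Ng [c Cc ec]]]] [h Nh [d [Cd Vd] e]]; subst.
  have [ed Zc] := uniq _ _ _ _ Ng Nh Cc Cd Zx e.
  by apply: Vd; rewrite ed; apply: FV; split => //; exact: (pullI _ g).
Qed.

End Slices.

(** * Invariant zero-dimensional pieces *)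

Section Decomposition.
Context (G : topologicalGroupType) (X : topologicalType) (act : G -> X -> X).
Hypotheses (hG : hausdorff_space G) (hX : hausdorff_space X).
Hypothesis actP : continuous_action act.
Hypothesis lG : locally_compact [set: G].

Lemma small_compact_nbhs (L : set G) (g : G) : identity_nbhd L ->
  exists N, [/\ compact N, nbhs g N &
    forall h k, N h -> N k -> L (h * k^-1)%g /\ L (h^-1 * k)%g].
Proof.
move=> nL.
have cm : continuous (fun p : G * G => (p.1 * p.2^-1)%g).
  move=> p; apply: (@continuous_comp _ _ _
    (fun p : G * G => (p.1, p.2^-1)%g) (fun p => (p.1 * p.2)%g)).
    apply: cvg_pair => /=; first exact: cvg_fst.
    apply: (@continuous_comp _ _ _ snd (fun g : G => g^-1%g)); first exact: cvg_snd.
    exact: invg_continuous.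
  exact: mulg_continuous.
have cm' : continuous (fun p : G * G => (p.1^-1 * p.2)%g).
  move=> p; apply: (@continuous_comp _ _ _
    (fun p : G * G => (p.1^-1, p.2)%g) (fun p => (p.1 * p.2)%g)).
    apply: cvg_pair => /=; last exact: cvg_snd.
    apply: (@continuous_comp _ _ _ fst (fun g : G => g^-1%g)); first exact: cvg_fst.
    exact: invg_continuous.
  exact: mulg_continuous.
have [|[A B] /= [nA nB] AB] := cm (g, g) L; first by rewrite /= mulgV.
have [|[A' B'] /= [nA' nB'] AB'] := cm' (g, g) L; first by rewrite /= mulVg.
have : nbhs g (A `&` B `&` (A' `&` B')) by apply: filterI; apply: filterI.
rewrite nbhsE => -[V [oV Vg] VA].
have [W [oW Wg cW WO]] := locally_compact_regular hG lG oV Vg.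
exists (closure W); split => //.
  by exists W => //; exact: subset_closure.
move=> h k /WO/VA[[Ah _] [Ah' _]] /WO/VA[[_ Bk] [_ Bk']]; split.
  exact: (AB (h, k)).
exact: (AB' (h, k)).
Qed.

Context (Q : nat -> set G).
Hypotheses (cQ : forall n, compact (Q n)) (QT : \bigcup_n Q n = setT).
Hypotheses (rX : regular X) (b : nat -> set X) (bX : countable_base b).
Context (L : set G).
Hypothesis nL : identity_nbhd L.

(* The orbits meeting the boundaries of a countable base of the slices C i are
   split off by the induction hypothesis; what remains meets each C i, hence
   each slice, in a zero-dimensional set. *)
Lemma invariant_decomposition (n : nat) (C : nat -> set X) :
  (forall i, slice act L (C i)) -> (forall i, ind_lt n (set_type (C i))) ->
  exists Z : nat -> set X, [/\ forall l, invariant act (Z l),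
    \bigcup_i C i `<=` \bigcup_(l in `I_n) Z l &
    forall l S, slice act L S -> zero_dim (Z l `&` S)].
Proof.
have L1 : L 1%g := nbhs_singleton nL.
pose small (N : set G) := compact N /\
  forall h k, N h -> N k -> L (h * k^-1)%g /\ L (h^-1 * k)%g.
have [||N [NP NT]] := @sigma_compact_cover _ _ small cQ QT.
- by split=> //; exact: compact0.
- by move=> g; have [N [cN nN NL]] := small_compact_nbhs g nL; exists N.
elim: n C => [|n ih] C sC iC.
  exists (fun=> set0); split; first by move=> l g x [].
    move=> x [i _ Cx]; have /= e := iC i.
    suff : set0 (exist _ x (mem_set Cx) : set_type (C i)) by [].
    by rewrite -e.
  by move=> l S _; rewrite set0I; exact: zero_dim0.
have WP i : exists W : nat -> set X, [/\ forall k, open (W k),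
    forall k, ind_lt n (set_type ((C i `&` closure (C i `&` W k)) `\` W k)) &
    forall x O, C i x -> open O -> O x ->
      exists2 k, W k x & C i `&` W k `<=` O].
  exact: ind_lt_countable_base bX (iC i).
have [W {}WP] := choice WP.
pose D i k := (C i `&` closure (C i `&` W i k)) `\` W i k.
(* The relative boundaries are compact parts of slices, hence slices, and form one sequence to which
   [ih] applies. *)
pose C' m := if unpickle m is Some (i, k) then D i k else set0.
have DC i k : D i k `<=` C i by move=> x [[]].
have [|m|Z' [iZ' CZ' zZ']] := ih C'.
- move=> m; rewrite /C'; case: unpickle => [[i k]|]; last first.
    apply: (sub_slice _ _ _ (sC 0%N)) => //; exact: compact0.
  apply: (sub_slice _ (@DC i k) _ (sC i)) => //.
  rewrite /D -setIDA setDE; apply: compact_closedI; first by case: (sC i).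
  apply: closedI; first exact: closed_closure.
  by apply: open_closedC; case: (WP i).
- rewrite /C'; case: unpickle => [[i k]|]; last exact: ind_lt_set0.
  by have [_ + _] := WP i; apply.
pose Z0 := [set x | exists g i, C i (act g x)] `\` \bigcup_(l in `I_n) Z' l.
have iZ0 : invariant act Z0.
  move=> g x [[h [i Cx]] nZ]; split.
    by exists (h * g^-1)%g, i; rewrite -(actM actP) mulgVK.
  by move=> [l ln Zx]; apply: nZ; exists l => //; rewrite -(actK actP g x); exact: iZ'.
exists (fun l => if l is l'.+1 then Z' l' else Z0); split.
- by case.
- move=> x [i _ Cx]; have [[l ln Zx]|nZ] := pselect ((\bigcup_(l in `I_n) Z' l) x).
    by exists l.+1.
  by exists 0%N => //; split=> //; exists 1%g, i; rewrite (act1 actP).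
case=> [|l] S sS; last exact: zZ'.
have zC i : zero_dim (Z0 `&` C i).
  have [oW _ bW] := WP i.
  apply: (@zero_dim_base _ (C i) Z0 (W i) oW) => [k x [[Zx Cx] clx]|x O [_ Cx]]; last exact: bW.
  (* A boundary point would lie in some [D i k], hence in a piece already split off. *)
  apply: contrapT => Wx; case: Zx => _; apply.
  by apply: CZ'; exists (pickle (i, k)) => //; rewrite /C' pickleK.
(* Points of [Z0] are translates of points of the [C i], so these countably many compact sets cover
   its trace on [S]. *)
pose M m := if unpickle m is Some (j, i) then act_set act (N j) (C i) else set0.
apply: (@zero_dim_countable_union _ rX _ bX _ M) => [m|m|x [[[g [i Cx]] nZ] Sx]].
- rewrite /M; case: unpickle => [[j i]|]; last exact: closed0.
  apply: compact_closed => //; apply: act_set_compact => //; first by case: (NP j).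
  by case: (sC i).
- rewrite /M; case: unpickle => [[j i]|].
    have [cN NL] := NP j; exact: (zero_dim_transport hX actP sS (sC i)).
  by rewrite setI0; exact: zero_dim0.
- have [j _ Nj] : (\bigcup_m N m) g^-1%g by rewrite NT.
  exists (pickle (j, i)) => //; rewrite /M pickleK.
  by exists g^-1%g => //; exists (act g x) => //; rewrite actK.
Qed.

End Decomposition.

(** * Greedy choice of slices *)

Section Greedy.
Context (G : topologicalGroupType) (X : topologicalType) (act : G -> X -> X).
Hypotheses (hG : hausdorff_space G) (hX : hausdorff_space X).
Hypothesis actP : continuous_action act.
Hypotheses (rX : regular X) (b : nat -> set X) (bX : countable_base b).

Lemma act_setS (K K' : set G) (S S' : set X) : K `<=` K' -> S `<=` S' ->
  act_set act K S `<=` act_set act K' S'.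
Proof.
by move=> KK SS _ [g Kg [x Sx <-]]; exists g; [exact: KK|exists x => //; exact: SS].
Qed.

Lemma act_set_interior (K K' : set G) (S : set X) (g : G) (x : X) :
  (forall h, K h -> K' (g * h)%g) -> interior (act_set act K S) x ->
  interior (act_set act K' S) (act g x).
Proof.
move=> KK; apply: (act_interior actP) => _ [h Kh [y Sy <-]].
by exists (g * h)%g; [exact: KK|exists y => //; rewrite (actM actP)].
Qed.

Context (K L M M' : set G).
Hypotheses (cK : compact K) (nL : identity_nbhd L) (LK : L `<=` K).
Hypotheses (cM : compact M) (MM' : forall g h, M g -> L h -> M' (g * h)%g).
Context (Z : set X).
Hypothesis iZ : invariant act Z.

(* The two closed sets T \ O and F below may meet, but not inside Z, so that
   they can only be separated along Z. This is why S' is kept disjoint from the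
   interior of M A and not from M A itself; the packing argument needs no more,
   since a point of an open tube lies on the orbit segment of a point of the
   tube interior of its slice. *)
Lemma greedy_step (A O S T : set X) : zero_dim (Z `&` S) ->
  compact A -> open O -> Z `&` act_set act M A `<=` O ->
  slice act K S -> closed T -> T `<=` S -> T `<=` interior (act_set act L S) ->
  exists S', [/\ compact S' /\ S' `<=` S,
    S' `&` interior (act_set act M A) = set0,
    Z `&` S' `<=` interior (act_set act L S') &
    Z `&` T `<=` S' `|` O].
Proof.
move=> zS cA oO AO sS cT TS TI; have [cS _] := sS.
have clS : closed S by exact: compact_closed.
(* What the new slice has to avoid: points outside the tube interior of [S], and points in conflict
   with [A]. *)
pose F := (S `\` interior (act_set act L S)) `|` (S `&` act_set act M A).
have cF : closed F.
  apply: closedU; last first.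
    by apply: closedI => //; apply: compact_closed => //; exact: act_set_compact.
  by rewrite setDE; apply: closedI => //; apply: open_closedC; exact: open_interior.
have cE : closed (T `\` O).
  by rewrite setDE; apply: closedI => //; exact: open_closedC.
have [|U [V [[oU oV] cov UV EU FV]]] := zero_dim_disjoint rX bX zS cE cF.
  rewrite -subset0 => x [[[Tx nO] [[_ nI]|[_ MAx]]] [Zx _]].
    by apply: nI; exact: TI.
  by apply: nO; apply: AO.
pose U' := U `\` F; have oU' : open U'.
  by rewrite /U' setDE; apply: openI => //; exact: closed_openC.
have US : closure (U' `&` S) `<=` S.
  by rewrite [X in _ `<=` X]((closure_id S).1 clS); apply: closureS => x [].
(* The closure adds no point of [Z], since the open set [V] is disjoint from [U]. Near a point of
   [Z] in it, the new slice is therefore all of [S], and [slice_interior] applies. *)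
have UZ x : Z x -> closure (U' `&` S) x -> U' x.
  move=> Zx clx; have Sx := US _ clx.
  have nV : ~ V x.
    move=> Vx; have [|y [[[Uy _] _] Vy]] := clx V; first exact: open_nbhs_nbhs.
    by suff : set0 y by []; rewrite -UV.
  by split; [have [] := cov x (conj Zx Sx)|move=> Fx; apply: nV; apply: FV].
exists (closure (U' `&` S)); split.
- by split => //; apply: (subclosed_compact _ cS) => //; exact: closed_closure.
- rewrite -subset0 => x [clx iMA]; have [y [[[_ nF] Sy] MAy]] := clx _ iMA.
  by apply: nF; right.
- move=> x [Zx clx]; have Sx := US _ clx; have [Ux nF] := UZ _ Zx clx.
  have ix : interior (act_set act L S) x.
    by apply: contrapT => n; apply: nF; left.
  have : interior (act_set act L (S `&` U')) x.
    apply: (slice_interior hG hX actP cK) => //.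
    by apply: interiorS ix; apply: act_setS.
  apply: interiorS; apply: act_setS => // y [Sy Uy].
  by apply: subset_closure.
- move=> x [Zx Tx]; have Sx := TS _ Tx.
  have [Ox|nO] := pselect (O x); [by right|left].
  apply: subset_closure; split => //; split; first exact: EU.
  move=> Fx; have : set0 x by rewrite -UV; split; [exact: EU|exact: FV].
  by [].
Qed.

(** The recursion carries the union of the slices chosen so far and an open set containing its
    [M]-translates along [Z]. The open set can be the union of the interiors of the [M']-tubes, as
    [M'] absorbs [M] times [L]. *)
Lemma greedy (S T : nat -> set X) : (forall j, zero_dim (Z `&` S j)) ->
  (forall j, slice act K (S j)) -> (forall j, closed (T j)) ->
  (forall j, T j `<=` S j) ->
  (forall j, T j `<=` interior (act_set act L (S j))) ->
  exists S' : nat -> set X, [/\ forall j, compact (S' j) /\ S' j `<=` S j,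
    forall i j, (i < j)%N -> S' j `&` interior (act_set act M (S' i)) = set0,
    forall j, Z `&` S' j `<=` interior (act_set act L (S' j)) &
    forall j, Z `&` T j `<=` interior (act_set act L (S' j)) `|`
      \bigcup_i interior (act_set act M' (S' i))].
Proof.
move=> zS sS cT TS TI.
pose inv (p : set X * set X) :=
  [/\ compact p.1, open p.2 & Z `&` act_set act M p.1 `<=` p.2].
have step j p : exists S', inv p -> [/\ compact S' /\ S' `<=` S j,
    S' `&` interior (act_set act M p.1) = set0,
    Z `&` S' `<=` interior (act_set act L S') & Z `&` T j `<=` S' `|` p.2].
  have [[c o h]|] := pselect (inv p); last by exists set0.
  have [S' ?] := greedy_step (zS j) c o h (sS j) (cT j) (@TS j) (@TI j).
  by exists S'.
pose f j p := projT1 (cid (step j p)).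
have fP j p : inv p -> [/\ compact (f j p) /\ f j p `<=` S j,
    f j p `&` interior (act_set act M p.1) = set0,
    Z `&` f j p `<=` interior (act_set act L (f j p)) &
    Z `&` T j `<=` f j p `|` p.2].
  by rewrite /f; case: cid.
pose s := fix s j := if j is i.+1 then ((s i).1 `|` f i (s i),
  (s i).2 `|` interior (act_set act M' (f i (s i)))) else (set0, set0).
have sI j : inv (s j).
  elim: j => [|j [c o h]].
    split; [exact: compact0|exact: open0|].
    by move=> x [_ [g _ [y []]]].
  have [[cf fS] _ fI _] := fP j (s j) (And3 c o h).
  split => /=; first exact: compactU.
    by apply: openU => //; exact: open_interior.
  move=> x [Zx [g Mg [y [sy|fy] e]]]; [left|right].
    by apply: h; split=> //; exists g => //; exists y.
  have Zy : Z y by rewrite -(actK actP g y) e; exact: iZ.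
  rewrite -e; apply: act_set_interior (fI y (conj Zy fy)) => k.
  exact: MM'.
have sub i j : (i < j)%N -> f i (s i) `<=` (s j).1.
  elim: j => // j ih; rewrite ltnS leq_eqVlt => /predU1P[->|/ih h] x fx.
    by right.
  by left; exact: h.
have sO j : (s j).2 `<=` \bigcup_i interior (act_set act M' (f i (s i))).
  by elim: j => [//|j ih] x [/ih//|ix]; exists j.
exists (fun j => f j (s j)); split.
- by move=> j; case: (fP j _ (sI j)).
- move=> i j ij; have [_ e _ _] := fP j _ (sI j).
  rewrite -subset0 -e => x [fx ix]; split => //.
  by apply: interiorS ix; apply: act_setS => //; exact: sub.
- by move=> j; case: (fP j _ (sI j)).
- move=> j x [Zx Tx]; have [_ _ h1 h2] := fP j _ (sI j).
  have [fx|Ox] := h2 x (conj Zx Tx); first by left; apply: h1.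
  by right; exact: sO Ox.
Qed.

End Greedy.

(** * Tubes over a zero-dimensional piece *)

Section Powers.
Context (G : topologicalGroupType) (Om : set G).

Lemma set_power1 : Om `<=` set_power Om 1.
Proof. by move=> g Og; exists g => //; exists 1%g => //; rewrite mulg1. Qed.

Lemma set_powerM (m n : nat) (g h : G) : set_power Om m g ->
  set_power Om n h -> set_power Om (m + n) (g * h)%g.
Proof.
elim: m g => [|m ih] g /=; first by move=> -> ?; rewrite mul1g.
move=> [a Oa [c /ih{}ih <-]] /ih nh.
by exists a => //; exists (c * h)%g; rewrite ?mulgA.
Qed.

Hypothesis Om1 : Om 1%g.

Lemma set_power_mono (m n : nat) : (m <= n)%N ->
  set_power Om m `<=` set_power Om n.
Proof.
move=> /subnKC <- g gm; rewrite addnC -(mul1g g); apply: set_powerM => //.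
elim: (n - m)%N => [//|k ih]; exists 1%g => //; exists 1%g => //.
by rewrite mulg1.
Qed.

Hypothesis OmV : forall g, Om g -> Om g^-1%g.

Lemma set_powerV (n : nat) (g : G) : set_power Om n g -> set_power Om n g^-1%g.
Proof.
elim: n g => [|n ih] g /=; first by move=> ->; rewrite invg1.
move=> [a Oa [c /ih{}ih <-]]; rewrite invgM.
have : set_power Om (n + 1) (c^-1 * a^-1)%g.
  by apply: set_powerM => //; apply: set_power1; exact: OmV.
by rewrite addn1.
Qed.

Hypothesis cOm : compact Om.

Lemma compact_mulg (A B : set G) : compact A -> compact B ->
  compact [set (g * h)%g | g in A & h in B].
Proof.
move=> cA cB.
have -> : [set (g * h)%g | g in A & h in B] =
    (fun p : G * G => (p.1 * p.2)%g) @` (A `*` B).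
  apply/seteqP; split=> [_ [g Ag [h Bh <-]]|_ [[g h] [/= Ag Bh] <-]].
    by exists (g, h).
  by exists g => //; exists h.
apply: continuous_compact; last exact: compact_setX.
by apply: continuous_subspaceT; exact: mulg_continuous.
Qed.

Lemma set_power_compact (n : nat) : compact (set_power Om n).
Proof.
by elim: n => [|n ih] /=; [exact: compact_set1|exact: compact_mulg].
Qed.

End Powers.

(* The disjoint translates of B_p by elements of B_(10 p) all lie in B_(11 p),
   where B_n is the n-th power of Om, so that N may be any integer with
   m(B_(11 p)) < (N + 1) m(B_p). *)
Definition packing_bound (G : topologicalGroupType) (Om : set G) (p N : nat) :
    Prop :=
  forall (s : seq nat) (g : nat -> G), uniq s ->
    (forall i, i \in s -> set_power Om (10 * p) (g i)) ->
    (forall i j h k, i \in s -> j \in s -> i != j -> set_power Om p h ->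
      set_power Om p k -> (g i * h)%g <> (g j * k)%g) ->
    (size s <= N)%N.

Section Tubes.
Context (G : topologicalGroupType) (X : topologicalType) (act : G -> X -> X).
Hypotheses (hG : hausdorff_space G) (hX : hausdorff_space X).
Hypothesis actP : continuous_action act.
Hypotheses (rX : regular X) (b : nat -> set X) (bX : countable_base b).

Lemma countable_slice_cover (K L : set G) : admits_slices act -> compact K ->
  identity_nbhd L -> L `<=` K ->
  exists S T : nat -> set X, [/\ forall j, slice act K (S j),
    forall j, closed (T j) /\ T j `<=` S j,
    forall j, T j `<=` interior (act_set act L (S j)) &
    \bigcup_j act_set act L (T j) = setT].
Proof.
move=> slicesP cK nL LK; have [bo bb] := bX.
pose good n (p : set X * set X) := [/\ slice act K p.1, closed p.2 /\ p.2 `<=` p.1,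
  p.2 `<=` interior (act_set act L p.1) & b n `<=` act_set act L p.2].
pose ST n := xget (set0, set0) (good n).
have STP n : [/\ slice act K (ST n).1, closed (ST n).2 /\ (ST n).2 `<=` (ST n).1 &
    (ST n).2 `<=` interior (act_set act L (ST n).1)].
  rewrite /ST; case: xgetP => [p _ []//|_] /=; split => //.
    by split; [exact: compact0|move=> p q /set_mem []].
  by split => //; exact: closed0.
exists (fun n => (ST n).1), (fun n => (ST n).2); split.
- by move=> n; case: (STP n).
- by move=> n; case: (STP n).
- by move=> n; case: (STP n).
rewrite -subTset => x _.
have nK : identity_nbhd K by exact: filterS nL.
have [S sS [Sx ix]] := slicesP K cK nK x.
have sI (U : set X) : open U -> U x -> interior (act_set act L (S `&` U)) x.
  by move=> oU Ux; apply: (slice_interior hG hX actP cK sS LK).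
have iLS : interior (act_set act L S) x.
  by have := sI setT openT I; rewrite setIT.
have [W [oW Wx WI]] := rX (@open_interior _ _) iLS.
have [n bnx bn] := bb _ _ (@open_interior _ _) (sI W oW Wx).
(* The closure of [W] lies in the interior of the [L]-tube, while [W] itself is large enough for [L]
   times its trace on [S] to contain [b n]. *)
have gST : good n (S, S `&` closure W).
  have [cS _] := sS.
  split => //=.
  - split; last by move=> y [].
    by apply: closedI; [exact: compact_closed|exact: closed_closure].
  - by move=> y [_ /WI].
  - apply: subset_trans bn _; apply: subset_trans (@interior_subset _ _) _.
    by apply: act_setS => // y [Sy Wy]; split => //; exact: subset_closure.
exists n => //; rewrite /ST; case: xgetP => [p _ [_ _ _]|/(_ _ gST)//]; exact.
Qed.

Context (Om : set G).
Hypotheses (Om1 : Om 1%g) (OmV : forall g, Om g -> Om g^-1%g).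
Hypotheses (cOm : compact Om) (nOm : identity_nbhd Om).
Local Notation B := (set_power Om).

Lemma zero_dim_tubes (p N : nat) (Z : set X) (S T : nat -> set X) :
  (0 < p)%N -> packing_bound Om p N -> invariant act Z ->
  (forall j, zero_dim (Z `&` S j)) -> (forall j, slice act (B (20 * p)) (S j)) ->
  (forall j, closed (T j) /\ T j `<=` S j) ->
  (forall j, T j `<=` interior (act_set act Om (S j))) ->
  \bigcup_j act_set act Om (T j) = setT ->
  exists U : nat -> set X, [/\ forall j, open_tube act (U j),
    forall x, Z x -> exists j, act_set act Om [set x] `<=` U j &
    forall x s, uniq s -> (forall j, j \in s -> U j x) -> (size s <= N)%N].
Proof.
move=> p0 pack iZ zS sS cT TI TX.
have cB n : compact (B n) by exact: set_power_compact.
have OmB n : (0 < n)%N -> Om `<=` B n.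
  by move=> n0; apply: subset_trans (@set_power1 _ Om) _; exact: set_power_mono.
have nB n : (0 < n)%N -> identity_nbhd (B n).
  by move=> n0; exact: filterS (OmB n n0) nOm.
have BOm n g h : B n g -> Om h -> B n.+1 (g * h)%g.
  by move=> Bg /set_power1 Bh; rewrite -addn1; exact: set_powerM.
have r0 : (0 < 20 * p)%N by rewrite muln_gt0.
(* Two meeting translates of [B p] cost [2 * p]; one more factor [Om] is the room given by a tube
   interior, and [M'] adds another. *)
have [|S' [S'S sep S'I cov]] := greedy hG hX actP rX bX (cB (20 * p)%N) nOm
  (OmB _ r0) (cB (2 * p).+1) (BOm (2 * p).+1) iZ zS sS (fun j => (cT j).1) _ TI.
  by move=> j; case: (cT j).
have sS' j n : (n <= 20 * p)%N -> slice act (B n) (S' j).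
  have [cS' SS] := S'S j => np; apply: (sub_slice _ SS cS' (sS j)).
  exact: set_power_mono.
exists (fun j => interior (act_set act (B (10 * p)) (S' j))); split.
- move=> j; exists (act_set act (B (10 * p)) (S' j)) => //.
  exists (B (10 * p)), (S' j); split => //; first by apply: nB; rewrite muln_gt0.
  by apply: sS'; lia.
- move=> x Zx; have [j _ [g Og [t Tt e]]] : (\bigcup_j act_set act Om (T j)) x.
    by rewrite TX.
  have Zt : Z t by rewrite -(actK actP g t) e; exact: iZ.
  (* One factor [Om] leads from [t] to [x], another from [x] to [Om x]. The largest case,
     [n = 2 * p + 2], fits because [p] is positive. *)
  have key n i : (n.+2 <= 10 * p)%N -> interior (act_set act (B n) (S' i)) t ->
      act_set act Om [set x] `<=` interior (act_set act (B (10 * p)) (S' i)).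
    move=> np it _ [k Ok [_ -> <-]]; rewrite -e -(actM actP).
    apply: (act_set_interior actP) it => h Bh.
    apply: (set_power_mono Om1 np); rewrite -addn2 addnC.
    by apply: set_powerM => //; apply: BOm => //; exact: set_power1.
  have [it|[i _ it]] := cov j t (conj Zt Tt).
    exists j; apply: (key 1%N); first by lia.
    by apply: interiorS it; apply: act_setS => //; exact: set_power1.
  by exists i; apply: (key (2 * p).+2) => //; lia.
move=> x s us sx.
have gP j : exists g, j \in s -> B (10 * p) g /\ S' j (act g^-1%g x).
  have [js|] := boolP (j \in s); last by exists 1%g.
  have /interior_subset [g Bg [y Sy e]] := sx j js.
  by exists g => _; rewrite -e (actK actP).
have [g {}gP] := choice gP.
apply: (pack s g) => // [i|]; first by case/gP.
(* Moving [x] back by an element of [B (10 * p)] enlarges the tube to [B (20 * p)], which is why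
   slices for that power are used. *)
have sI j : j \in s -> interior (act_set act Om (S' j)) (act (g j)^-1%g x).
  move=> js; have [Bg Sg] := gP j js.
  have := slice_interior hG hX actP (cB (20 * p)%N) (sS' j _ (leqnn _))
    (OmB _ r0) nOm openT; rewrite setIT; apply; first by [].
  apply: (act_set_interior actP) (sx j js) => h Bh.
  rewrite (_ : 20 * p = 10 * p + 10 * p)%N; last by lia.
  by apply: set_powerM => //; exact: set_powerV.
(* Otherwise [k * h^-1], in [B (2 * p)], moves the base point of [x] in [S' i] to that in [S' j],
   against [sep]. *)
have main i j h k : (i < j)%N -> i \in s -> j \in s -> B p h -> B p k ->
    (g i * h)%g <> (g j * k)%g.
  move=> ij si sj Bh Bk e.
  suff : set0 (act (g j)^-1%g x) by [].
  rewrite -(sep _ _ ij); split; first by case: (gP j sj).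
  have -> : act (g j)^-1%g x = act (k * h^-1)%g (act (g i)^-1%g x).
    rewrite -(actM actP); congr (act _ _).
    by rewrite -[in LHS](mulgK k (g j)) -e !invgM invgK mulgA.
  apply: (act_set_interior actP) (sI i si) => l Ol.
  rewrite (_ : (2 * p).+1 = (p + p).+1)%N; last by lia.
  by apply: BOm => //; apply: set_powerM => //; exact: set_powerV.
move=> i j h k si sj; rewrite neq_ltn => /orP[ij|ji] Bh Bk; first exact: main.
by move=> /esym; exact: main.
Qed.

End Tubes.

(** * Packing translates *)

(** For [e = c / (2 * N + 2)], the number [(N + 1) * (c - e)] exceeds [N * (c + e)] by exactly
    [e]. *)
Lemma packing_arith (R : realFieldType) (N k : nat) (c q x y : R) :
  (0 < c)%R -> (0 < q)%R -> (N < k)%N ->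
  (x < (c + c / (2 * N%:R + 2)) * (N%:R * q))%R ->
  ((c - c / (2 * N%:R + 2)) * q < y)%R -> (x < k%:R * y)%R.
Proof.
move=> c0 q0 Nk xlt ylt.
have n0 : (0 <= N%:R :> R)%R by rewrite ler0n.
have nk : (N%:R + 1 <= k%:R :> R)%R by rewrite natr1 ler_nat.
have t0 : (2 * N%:R + 2 != 0 :> R)%R by apply: lt0r_neq0; lra.
move: (N%:R : R)%R (k%:R : R)%R n0 nk t0 xlt ylt => n l n0 nl t0 xlt ylt.
have cE : (c = c / (2 * n + 2) * (2 * n + 2))%R by rewrite mulfVK.
move: (c / (2 * n + 2))%R cE xlt ylt => e cE xlt ylt.
have e0 : (0 < e)%R by nra.
have y0 : (0 < y)%R by apply: lt_trans ylt; rewrite mulr_gt0 // cE; nra.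
apply: lt_le_trans (_ : (n + 1) * y <= _)%R; last by rewrite ler_wpM2r // ltW.
apply: lt_trans xlt _; apply: le_lt_trans (_ : _ <= (n + 1) * ((c - e) * q))%R _.
  by rewrite mulrA mulrA ler_wpM2r ?(ltW q0) // cE; nra.
by rewrite ltr_pM2l //; lra.
Qed.

Section Packing.
Import numFieldNormedType.Exports.
Context (R : realType) (G : topologicalGroupType).
Hypothesis hG : hausdorff_space G.

Lemma compact_measurable (A : set G) : compact A -> measurable (A : set (borel G)).
Proof.
move=> /(compact_closed hG) cA; rewrite -(setCK A); apply: measurableC.
by apply: sub_sigma_algebra; exact: closed_openC.
Qed.

Context (m : {measure set (borel G) -> \bar R}).
Hypothesis hm : haar_measure m.

Lemma haar_packing (A D : set G) (s : seq nat) (g : nat -> G) :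
  compact A -> compact D -> uniq s ->
  (forall i h, i \in s -> A h -> D (g i * h)%g) ->
  (forall i j h k, i \in s -> j \in s -> i != j -> A h -> A k ->
    (g i * h)%g <> (g j * k)%g) ->
  ((size s)%:R * fine (m A) <= fine (m D))%R.
Proof.
move=> cA cD us AD dis.
have fin C : compact C -> m C \is a fin_num.
  by move=> cC; rewrite ge0_fin_numE //; exact: haar_compact.
pose F i : set (borel G) := [set (g i * h)%g | h in A].
have mF i : measurable (F i).
  apply: compact_measurable; apply: continuous_compact => //.
  apply: continuous_subspaceT => x.
  apply: (@continuous_comp _ _ _ (pair (g i)) (fun p => (p.1 * p.2)%g)).
    by apply: cvg_pair => /=; [exact: cvg_cst|exact: cvg_id].
  exact: mulg_continuous.
have tF : trivIset [set` s] F.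
  apply/trivIsetP => i j si sj ij; rewrite -subset0 => x [[h Ah <-] [k Ak e]].
  by have := dis i j h k si sj ij Ah Ak; rewrite e.
have mU : measurable (\bigcup_(i in [set` s]) F i).
  exact: fin_bigcup_measurable.
have UD : \bigcup_(i in [set` s]) F i `<=` D.
  by move=> x [i si [h Ah <-]]; exact: AD.
have : m (\bigcup_(i in [set` s]) F i) <= m D.
  exact: (le_measure m (mem_set mU) (mem_set (compact_measurable cD)) UD).
have -> : m (\bigcup_(i in [set` s]) F i) = \sum_(i <- s) m (F i).
  rewrite measure_fin_bigcup //; last exact: finite_seq.
  by rewrite (@fsbig_seq _ _ _ _ _ (fun i => m (F i)) us).
under eq_bigr => i _ do rewrite (haar_invariant hm (g i) (compact_measurable cA)).
rewrite -(fineK (fin A cA)) -(fineK (fin D cD)) sumEFin lee_fin.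
by rewrite big_const_seq count_predT iter_addr addr0 mulr_natl.
Qed.

Lemma packing_bound_exists (Om : set G) (d : nat) :
  compact_symmetric_generating Om -> Om 1%g -> is_growth_degree R G d ->
  exists2 p, (0 < p)%N & packing_bound Om p (11 ^ d).
Proof.
move=> gO O1 /(_ Om m gO hm) [c c0]; have cOm := generating_compact gO.
have cB n : compact (set_power Om n) by exact: set_power_compact.
pose mu n : R := fine (m (set_power Om n)).
have muE n : m (set_power Om n) = (mu n)%:E.
  by rewrite fineK // ge0_fin_numE //; exact: haar_compact.
move=> /fine_cvgP [_ mu_cvg].
have {}mu_cvg : (mu n * n%:R ^- d)%R @[n --> \oo] --> c.
  by apply: cvg_trans mu_cvg; apply: near_eq_cvg; near=> n; rewrite /= muE.
pose N : nat := 11 ^ d.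
pose e : R := (c / (2 * N%:R + 2))%R.
have e0 : (0 < e)%R by rewrite divr_gt0 // ltr_wpDl // mulr_ge0.
have [n1 _ up] : \forall n \near \oo, (mu n * n%:R ^- d < c + e)%R.
  by apply: (cvgr_lt _ mu_cvg); rewrite ltrDl.
have [n2 _ lo] : \forall n \near \oo, (c - e < mu n * n%:R ^- d)%R.
  by apply: (cvgr_gt _ mu_cvg); rewrite ltrBlDr ltrDl.
(* Both [p] and [11 * p] are beyond the two thresholds, and [p] is positive. *)
pose p := (maxn n1 n2).+1.
have pd0 k : (0 < k)%N -> (0 < k%:R ^+ d :> R)%R by move=> k0; rewrite exprn_gt0 ?ltr0n.
have {}up : (mu (11 * p)%N < (c + e) * (11 * p)%:R ^+ d)%R.
  rewrite -ltr_pdivrMr ?pd0 ?muln_gt0 //; apply: up => /=.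
  by rewrite /p; have := leq_maxl n1 n2; lia.
have {}lo : ((c - e) * p%:R ^+ d < mu p)%R.
  rewrite -ltr_pdivlMr ?pd0 //; apply: lo => /=.
  by rewrite /p; have := leq_maxr n1 n2; lia.
exists p => // s g us gs dis; rewrite leqNgt; apply/negP => sN.
have AD i h : i \in s -> set_power Om p h -> set_power Om (11 * p) (g i * h)%g.
  move=> si ph; rewrite (_ : 11 * p = 10 * p + p)%N; last by lia.
  by apply: set_powerM => //; exact: gs.
have := haar_packing (cB p) (cB (11 * p)%N) us AD dis.
apply/negP; rewrite -ltNge.
apply: packing_arith c0 (pd0 p isT) sN _ lo.
rewrite [X in (_ < _ * X)%R](_ : _ = (11 * p)%:R ^+ d)%R //.
by rewrite natrX natrM exprMn.
Unshelve. all: by end_near. Qed.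

End Packing.

(** * Covers by open tubes *)

Section Main.
Context (R : realType) (G : topologicalGroupType) (X : topologicalType).
Context (act : G -> X -> X) (d : nat).
Hypotheses (hG : hausdorff_space G) (lG : locally_compact [set: G]).
Hypotheses (growthG : polynomial_growth R G) (degG : is_growth_degree R G d).
Hypotheses (hX : hausdorff_space X) (lX : locally_compact [set: X]).
Hypotheses (scX : @second_countable X).
Hypotheses (actP : continuous_action act) (slicesP : admits_slices act).

Lemma set_powerS (A B : set G) (n : nat) : A `<=` B ->
  set_power A n `<=` set_power B n.
Proof.
move=> AB; elim: n => [//|n ih] _ [g Ag [h Ah <-]].
by exists g; [exact: AB|exists h => //; exact: ih].
Qed.

(** The growth degree is the same for all generating sets, so [K] may be absorbed into one; tubes
    containing [Om x] then contain [K x]. *)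
Lemma enlarge_generating (Om K : set G) : compact_symmetric_generating Om ->
  compact K ->
  exists Om', [/\ compact_symmetric_generating Om', K `<=` Om' &
    forall g, Om' g -> Om' g^-1%g].
Proof.
move=> [neO cO sO gO] cK.
have cV (A : set G) : compact A -> compact [set g^-1%g | g in A].
  move=> cA; apply: continuous_compact => //; apply: continuous_subspaceT.
  exact: invg_continuous.
pose Om' := Om `|` (K `|` [set g^-1%g | g in K]).
have V g : Om' g -> Om' g^-1%g.
  case=> [Og|[Kg|[h Kh <-]]].
  - by left; rewrite -sO; exists g.
  - by right; right; exists g.
  - by right; left; rewrite invgK.
exists Om'; split => //; last by move=> g Kg; right; left.
split.
- by have [g Og] := neO; exists g; left.
- by apply: compactU => //; apply: compactU => //; exact: cV.
- apply/seteqP; split=> [_ [g /V Vg <-]//|g /V Vg].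
  by exists g^-1%g => //; rewrite invgK.
- rewrite -subTset -gO => g [n _ ng]; exists n => //.
  by apply: set_powerS ng => h Oh; left.
Qed.

Lemma pigeonhole (I : Type) (s : seq I) (k : I -> nat) (n N : nat) :
  all (fun i => k i < n)%N s ->
  (forall c, (c < n)%N -> (count (fun i => k i == c) s <= N)%N) ->
  (size s <= N * n)%N.
Proof.
elim: n s => [|n ih] s kn cN.
  by case: s kn {cN} => [|i s] //=; rewrite muln0.
rewrite mulnS -(count_predC (fun i => k i == n) s).
apply: leq_add; first exact: cN.
rewrite -size_filter; apply: ih.
  rewrite all_filter; apply: sub_all kn => i /=; rewrite ltnS leq_eqVlt.
  by case: eqP.
move=> c cn; apply: leq_trans (cN c (ltnW cn)).
by rewrite count_filter; apply: sub_count => i /= /andP[].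
Qed.

Lemma open_tube_open (A : set X) : open_tube act A -> open A.
Proof. by move=> [B _ ->]; exact: open_interior. Qed.

Lemma tube_cover (K : set G) (n : nat) : compact K -> identity_nbhd K ->
  ind_lt n X ->
  exists U : set (set X), [/\ forall A, U A -> open_tube act A,
    forall x, exists2 A, U A & act_set act K [set x] `<=` A &
    multiplicity R U <= (11 ^ d * n)%:R%:E].
Proof.
move=> cK nK indX; have [b bX] := second_countable_base scX.
have rX : regular X.
  move=> x O oO Ox.
  by have [W [oW Wx _ WO]] := locally_compact_regular hX lX oO Ox; exists W.
have [Om0 [m [_ [_ [gO0 hm _ _]]]]] := growthG.
have [Om [gO KO VO]] := enlarge_generating gO0 cK.
have cO := generating_compact gO.
have nO : identity_nbhd Om by exact: filterS nK.
have O1 : Om 1%g := nbhs_singleton nO.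
have [p p0 pack] := packing_bound_exists hG hm gO O1 degG.
have cB k : compact (set_power Om k) by exact: set_power_compact.
have OB : Om `<=` set_power Om (20 * p).
  by apply: subset_trans (@set_power1 _ Om) _; apply: set_power_mono => //; lia.
have [S [T [sS cT TI TX]]] :=
  countable_slice_cover hG hX actP rX bX slicesP (cB _) nO OB.
have sOS j : slice act Om (S j) by apply: (sub_slice OB (@subset_refl _ _) _ (sS j)); case: (sS j).
have [|Z [iZ SZ zZ]] := invariant_decomposition hG hX actP lG cB
  (generating_cover gO) rX bX nO sOS (n := n).
  by move=> j; exact: ind_lt_set_type.
have [U UP] := choice (fun k => zero_dim_tubes hG hX actP rX bX O1 VO cO nO p0
  pack (iZ k) (fun j => zZ k _ (sOS j)) sS cT TI TX).
(* [n] is a bound for the dimension plus one, and only the first [n] invariant pieces are used. *)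
pose F := [set A | exists2 k, (k < n)%N & exists j, A = U k j].
exists F; split.
- by move=> A [k kn [j ->]]; case: (UP k).
- move=> x; have [j _ [g Og [t Tt e]]] : (\bigcup_j act_set act Om (T j)) x.
    by rewrite TX.
  have [|k kn Zt] := SZ t; first by exists j => //; case: (cT j) => _; apply.
  have [_ h _] := UP k; have [|i xi] := h x; first by rewrite -e; exact: iZ.
  exists (U k i); first by exists k => //; exists i.
  by apply: subset_trans xi; apply: act_setS.
(* If [11 ^ d * n + 1] distinct members shared a point, more than [11 ^ d] of them would belong to
   one piece; being distinct sets, they have distinct indices there. *)
apply: ereal_inf_lbound; exists (11 ^ d * n)%N => //= V VF Vcard.
rewrite -subset0 => x Vx.
have /card_set_bijP[f [fV finj _]] : (`I_(11 ^ d * n).+1 #= V)%card.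
  by rewrite card_eq_sym.
have kP i : exists kj, (i < (11 ^ d * n).+1)%N ->
    (kj.1 < n)%N /\ f i = U kj.1 kj.2.
  have [li|] := boolP (i < (11 ^ d * n).+1)%N; last by exists (0, 0)%N.
  by have [k kn [j e]] := VF _ (fV i li); exists (k, j).
have [kj {}kP] := choice kP.
have : (size (iota 0 (11 ^ d * n).+1) <= 11 ^ d * n)%N.
  apply: (pigeonhole (k := fun i => (kj i).1)).
    by apply/allP => i; rewrite mem_iota => /kP[].
  move=> c cn; have [_ _ bound] := UP c.
  set s := [seq i <- iota 0 (11 ^ d * n).+1 | (kj i).1 == c].
  have sP i : i \in s -> [/\ (i < (11 ^ d * n).+1)%N, (kj i).1 = c &
      f i = U c (kj i).2].
    by rewrite mem_filter mem_iota => /andP[/eqP <- /= li]; case: (kP i li).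
  rewrite -size_filter -/s -(size_map (fun i => (kj i).2)); apply: (bound x).
    rewrite map_inj_in_uniq ?filter_uniq ?iota_uniq // => i j /sP[li _ ei].
    move=> /sP[lj _ ej] e; apply: finj; rewrite ?inE //.
    by rewrite ei ej e.
  move=> j /mapP[i /sP[li _ e] ->]; rewrite -e.
  by apply: Vx; apply: fV.
by rewrite size_iota ltnn.
Qed.

(** This serves infinite dimension, where multiplicity is unconstrained. A slice for the product of
    [K] with itself leaves room to move the tube interior by [K]. *)
Lemma open_tube_nbhs (K : set G) (x : X) : compact K -> identity_nbhd K ->
  exists2 A, open_tube act A & act_set act K [set x] `<=` A.
Proof.
move=> cK nK; pose KK := [set (g * h)%g | g in K & h in K].
have K1 : K 1%g := nbhs_singleton nK.
have KKK : K `<=` KK by move=> g Kg; exists g => //; exists 1%g; rewrite ?mulg1.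
have cKK : compact KK by exact: compact_mulg.
have nKK : identity_nbhd KK by exact: filterS nK.
have [S sS [Sx ix]] := slicesP cKK nKK x.
exists (interior (act_set act KK S)).
  by exists (act_set act KK S) => //; exists KK, S; split.
have {}ix : interior (act_set act K S) x.
  have := slice_interior hG hX actP cKK sS KKK nK openT.
  by rewrite setIT; apply.
move=> _ [g Kg [_ -> <-]]; apply: (act_set_interior actP) ix => h Kh.
by exists g => //; exists h.
Qed.

Lemma small_ind_min (n : nat) : ind_lt n X -> (forall k, ind_lt k X -> (n <= k)%N) ->
  small_ind R X = (n%:R - 1)%:E.
Proof.
move=> indn nmin; apply/eqP; rewrite eq_le; apply/andP; split.
  by apply: ereal_inf_lbound; exists n.
apply: le_ereal_inf_tmp => _ [k indk <-].
by rewrite lee_fin lerB // ler_nat nmin.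
Qed.

End Main.

Theorem theorem4p2 (R : realType) (G : topologicalGroupType)
    (X : topologicalType) (act : G -> X -> X) (d : nat)
    (G_hausdorff : hausdorff_space G)
    (G_locally_compact : locally_compact [set: G])
    (G_growth : polynomial_growth R G)
    (G_degree : is_growth_degree R G d)
    (X_hausdorff : hausdorff_space X)
    (X_locally_compact : locally_compact [set: X])
    (X_second_countable : @second_countable X)
    (act_action : continuous_action act)
    (act_slices : admits_slices act) :
  (forall K : set G, compact K -> identity_nbhd K ->
    exists U : set (set X),
      [/\ (forall A, U A -> open A) /\ \bigcup_(A in U) A = [set: X],
          forall A, U A -> open_tube act A,
          multiplicity R U <= (11 ^+ d)%:E * (small_ind R X + 1)
        & forall x, exists2 A, U A & act_set act K [set x] `<=` A]) /\
  ([set: X] !=set0 ->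
    tube_dim act R <= (11 ^+ d)%:E * (small_ind R X + 1) - 1).
Proof.
have cover K (U : set (set X)) : identity_nbhd K ->
    (forall x, exists2 A, U A & act_set act K [set x] `<=` A) ->
    \bigcup_(A in U) A = [set: X].
  move=> nK KU; rewrite -subTset => x _; have [A UA KA] := KU x.
  exists A => //; apply: KA; exists 1%g; first exact: nbhs_singleton.
  by exists x => //; exact: act1.
(* In infinite dimension the bound is infinite and the family of all open tubes will do. *)
have [ex|nex] := pselect (exists n, `[< ind_lt n X >]); last first.
  have -> : (11 ^+ d)%:E * (small_ind R X + 1) = +oo.
    rewrite /small_ind (_ : [set _ | _ in _] = set0).
      by rewrite ereal_inf0 addye // gt0_muley // lte_fin exprn_gt0.
    rewrite -subset0 => y [n indn _]; apply: nex.
    by exists n; apply/asboolP.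
  split=> [K cK nK|_]; last by rewrite addye // leey.
  have KU x := open_tube_nbhs G_hausdorff X_hausdorff act_action act_slices x cK nK.
  exists (open_tube act); split; rewrite ?leey //.
  by split; [exact: open_tube_open|exact: cover nK KU].
case: (ex_minnP ex) => n /asboolP indn nmin.
rewrite (@small_ind_min _ _ n) //; last by move=> k indk; apply/nmin/asboolP.
have -> : (11 ^+ d)%:E * ((n%:R - 1)%:E + 1) = (11 ^ d * n)%:R%:E :> \bar R.
  by rewrite -EFinD subrK -EFinM natrM natrX.
have tubes K (cK : compact K) (nK : identity_nbhd K) :=
  tube_cover G_hausdorff G_locally_compact G_growth G_degree X_hausdorff
    X_locally_compact X_second_countable act_action act_slices cK nK indn.
split=> [K cK nK|[x0 _]].
  have [U [Ut KU mU]] := tubes K cK nK.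
  exists U; split => //; split; last exact: cover nK KU.
  by move=> A /Ut/open_tube_open.
(* Nonemptiness makes [11 ^ d * n] positive, so its predecessor is a legitimate value for the tube
   dimension; for empty [X] the bound would be -1. *)
have n0 : (0 < n)%N.
  case: n indn {ex nmin tubes} => [X0|//].
  by suff : (set0 : set X) x0 by []; rewrite -X0.
apply: ereal_inf_lbound; exists (11 ^ d * n).-1; last first.
  by rewrite -EFinB -subn1 natrB // muln_gt0 expn_gt0.
(* Here [K] is an arbitrary compact set, so a compact identity neighbourhood is adjoined to it. *)
move=> K Y cK cY; have [V nV' [cV _]] := G_locally_compact 1%g I.
have nV : nbhs (1%g : G) V by move: nV'; rewrite /within /=; apply: filterS => g; apply.
have [|| U [Ut KU mU]] := tubes (K `|` V).
- exact: compactU.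
- by apply: filterS nV => g; right.
exists U; split.
- by move=> A /Ut/open_tube_open.
- move=> x _; have [A UA KA] := KU x; exists A => //.
  by apply: subset_trans KA; apply: act_setS => // g; left.
- by move=> A /Ut[B tB ->]; exists B => //; exact: interior_subset.
- by rewrite prednK // muln_gt0 expn_gt0.
Qed.
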